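(* Let $Y=C+E\in F^{L\times n}$ where $C$ is a codeword of the interleaved Reed--Solomon code and $|U_E|\le n-k_{\max}$. Then $E$ satisfies the partial-inverse condition if and only if the SPI solution of $$\deg\big(\breve S^{(i)}(x)\Lambda(x)\bmod x^{n-k^{(i)}}\big)<|U_E|,\qquad i=1,\ldots,L,$$ is $\Lambda_E(x)$ (up to a nonzero scale factor). Moreover, if $E$ satisfies the partial-inverse condition, then for all $i\in\{1,\ldots,L\}$ $$Y^{(i)}(x)\Lambda_E(x)\ \mathrm{div}\ m(x)=\breve S^{(i)}(x)\Lambda_E(x)\ \mathrm{div}\ x^{n-k^{(i)}}.$$
   Context: For polynomials, $\bmod$ and $\mathrm{div}$ denote remainder and quotient of polynomial division; the degree of the zero polynomial is $-\infty$; the coefficient of $x^d$ in a polynomial is denoted by the subscript $d$. Code: $F$ is a finite field, $\beta_0,\ldots,\beta_{n-1}$ are $n$ distinct elements of $F$ (one may be $0$), $m(x):=\prod_{\ell=0}^{n-1}(x-\beta_\ell)$, and $\psi:F[x]/m(x)\to F^n$, $a(x)\mapsto(a(\beta_0),\ldots,a(\beta_{n-1}))$, a ring isomorphism; $\psi^{-1}(v)$ is identified with the unique polynomial of degree less than $n$ whose values at $\beta_0,\ldots,\beta_{n-1}$ are the entries of $v$. Codewords are the arrays in $F^{L\times n}$ ($L\ge1$) whose $i$-th row $c^{(i)}$ satisfies $\deg\psi^{-1}(c^{(i)})<k^{(i)}$, $i=1,\ldots,L$, where $k^{(i)}$ is the dimension of the $i$-th row code. Let $k_{\max}:=\max_i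 k^{(i)}$; it is assumed that $k_{\max}<n$. Errors: for $E\in F^{L\times n}$ with rows $e^{(i)}$ and columns $e_0,\ldots,e_{n-1}$, put $E^{(i)}(x):=\psi^{-1}(e^{(i)})$, $U_E:=\{\ell:e_\ell\ne0\}$ and $\Lambda_E(x):=\prod_{\ell\in U_E}(x-\beta_\ell)$. For $Y$ with rows $y^{(i)}$, $Y^{(i)}(x):=\psi^{-1}(y^{(i)})$. SPI solution: a finite set of inequalities $\deg(b^{(i)}(x)\Lambda(x)\bmod m^{(i)}(x))<\tau^{(i)}$, $i=1,\ldots,L$ (with $\deg m^{(i)}\ge1$, $\deg b^{(i)}<\deg m^{(i)}$, $0\le\tau^{(i)}\le\deg m^{(i)}$), has an SPI solution, namely the nonzero polynomial $\Lambda(x)$ of smallest degree satisfying all of them; it exists and is unique up to a nonzero scale factor. Partial-inverse condition: $E$ satisfies it if $|U_E|\le n-k_{\max}$ and the SPI solution of $\deg(E^{(i)}(x)\Lambda(x)\bmod m(x))<k^{(i)}+|U_E|$, $i=1,\ldots,L$, is $\Lambda_E(x)$ (up to a nonzero scale factor). Syndromes: $S^{(i)}(x):=Y^{(i)}_{k^{(i)}}+Y^{(i)}_{k^{(i)}+1}x+\cdots+Y^{(i)}_{n-1}x^{n-k^{(i)}-1}$ and $\tilde m^{(i)}(x):=m_{k^{(i)}}+m_{k^{(i)}+1}x+\cdots+m_nx^{n-k^{(i)}}$. Monomialized syndromes: let $\overline S^{(i)}(x):=x^{n-k^{(i)}-1}S^{(i)}(x^{-1})$, $\overline m^{(i)}(x):=x^{n-k^{(i)}}\tilde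 m^{(i)}(x^{-1})$, let $w^{(i)}(x)$ be the inverse of $\overline m^{(i)}(x)$ in $F[x]/x^{n-k^{(i)}}$, let $s^{(i)}(x):=w^{(i)}(x)\overline S^{(i)}(x)\bmod x^{n-k^{(i)}}$, and $\breve S^{(i)}(x):=x^{n-k^{(i)}-1}s^{(i)}(x^{-1})$. *)

(* Defs.v *)
From HB Require Import structures.
From mathcomp Require Import all_boot all_order all_algebra.
Set Implicit Arguments.
Unset Strict Implicit.
Unset Printing Implicit Defensive.
Import GRing.Theory.
Local Open Scope ring_scope.

(* Since [size p] is deg p + 1, with [size 0 = 0]
   standing for deg 0 = -oo, the condition deg p < t reads [size p <= t]. *)

Section SPI.
Variables (F : fieldType) (L : nat).
Implicit Types (b m : 'I_L -> {poly F}) (tau : 'I_L -> nat).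
Implicit Types (Lam p : {poly F}).

Definition spi_ineqs b m tau Lam : Prop :=
  forall i : 'I_L, (size ((b i * Lam) %% m i)%R <= tau i)%N.

Definition spi_solution b m tau Lam : Prop :=
  [/\ Lam != 0, spi_ineqs b m tau Lam &
      forall Lam' : {poly F},
        Lam' != 0 -> spi_ineqs b m tau Lam' -> (size Lam <= size Lam')%N].

(* "The SPI solution is p, up to a nonzero scale factor": the SPI solutions are
   exactly the nonzero scalar multiples of p. *)
Definition spi_solution_is b m tau p : Prop :=
  forall Lam : {poly F}, spi_solution b m tau Lam <-> Lam %= p.

End SPI.

Section Code.
Variables (F : finFieldType) (n : nat) (beta : 'I_n -> F).

Definition nodepoly : {poly F} := \prod_(l < n) ('X - (beta l)%:P).

(* psi, with the elements of F[x]/m(x) represented by the polynomials of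
   degree less than n. *)
Definition psi (a : {poly_n F}) : 'rV[F]_n := \row_(l < n) a.[beta l].

(* The default value 0 is never reached when beta is injective, see psi_invK. *)
Definition psi_inv (v : 'rV[F]_n) : {poly_n F} :=
  odflt 0 [pick a : {poly_n F} | psi a == v].

Lemma psi_inj : injective beta -> injective psi.
Proof.
move=> inj_beta a b eq_ab; apply/val_inj/eqP; rewrite -subr_eq0 /=.
apply/negPn/negP => nz_d.
have := max_poly_roots nz_d (rs := codom beta) _ _.
rewrite size_codom card_ord ltnNge.
rewrite (leq_trans (size_polyD _ _)) ?size_polyN ?geq_max ?size_npoly //.
move=> H; suff: false by []; apply: H; last by rewrite map_inj_uniq ?enum_uniq.
apply/allP => _ /codomP[l ->]; rewrite rootE hornerD hornerN subr_eq0.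
by move/rowP: eq_ab => /(_ l); rewrite !mxE => ->.
Qed.

Lemma psi_invK : injective beta -> cancel psi_inv psi.
Proof.
move=> inj_beta v; rewrite /psi_inv; case: pickP => [a /eqP //|no_a].
have [g _ gK] : bijective psi.
  apply: inj_card_bij; first exact: psi_inj.
  by rewrite card_npoly card_mx mul1n.
by have := no_a (g v); rewrite gK eqxx.
Qed.

Lemma psiK : injective beta -> cancel psi psi_inv.
Proof. by move=> inj_beta a; apply: (psi_inj inj_beta); rewrite psi_invK. Qed.

Section Array.
Variables (L : nat).
Implicit Types (C E Y : 'M[F]_(L, n)) (k : 'I_L -> nat) (i : 'I_L).

Definition rowpoly Y i : {poly F} := psi_inv (row i Y).

Definition codeword k C : Prop :=
  forall i, (size (rowpoly C i) <= k i)%N.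

Definition kmax k : nat := \max_(i < L) k i.

Definition errset E : {set 'I_n} := [set l | col l E != 0].

Definition errloc E : {poly F} := \prod_(l in errset E) ('X - (beta l)%:P).

Definition partial_inverse_condition k E : Prop :=
  (#|errset E| <= n - kmax k)%N /\
  spi_solution_is (rowpoly E) (fun=> nodepoly)
    (fun i => (k i + #|errset E|)%N) (errloc E).

(* x^d p(x^-1); only meaningful for deg p <= d, which holds at each use below
   when k i < n. *)
Definition reversal (d : nat) (p : {poly F}) : {poly F} :=
  \poly_(j < d.+1) p`_(d - j).

Definition synd k Y i : {poly F} :=
  \poly_(j < n - k i) (rowpoly Y i)`_(k i + j).

Definition mtilde k i : {poly F} := \poly_(j < (n - k i).+1) nodepoly`_(k i + j).

Definition synd_rev k Y i : {poly F} := reversal (n - k i - 1) (synd k Y i).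

Definition mbar k i : {poly F} := reversal (n - k i) (mtilde k i).

(* The inverse is taken in the ring F[x]/x^(n-k_i); it is a genuine inverse by
   winvP. *)
Definition winv k i : {poly %/ ('X^(n - k i) : {poly F})} :=
  (in_qpoly 'X^(n - k i) (mbar k i))^-1.

Definition synd_series k Y i : {poly F} :=
  ((winv k i : {poly F}) * synd_rev k Y i) %% 'X^(n - k i).

Definition mono_synd k Y i : {poly F} :=
  reversal (n - k i - 1) (synd_series k Y i).

Lemma coef0_mbar k i : (k i < n)%N -> (mbar k i)`_0 = 1.
Proof.
move=> lt_k; rewrite coef_poly /= subn0 coef_poly ltnSn subnKC ?(ltnW lt_k) //.
have /monicP : nodepoly \is monic by apply: monic_prod => l _; apply: monicXsubC.
by rewrite lead_coefE size_prod_XsubC [index_enum _]unlock -enumT size_enum_ord.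
Qed.

Lemma winvP k i : (k i < n)%N ->
  ((winv k i : {poly F}) * mbar k i) %% 'X^(n - k i) = 1.
Proof.
move=> lt_k; set N := (n - k i)%N.
have N_gt0 : (0 < N)%N by rewrite subn_gt0.
have mkN : mk_monic 'X^N = 'X^N :> {poly F} by rewrite mk_monic_Xn prednK.
have cop : coprimep (mk_monic 'X^N) (in_qpoly 'X^N (mbar k i)).
  rewrite /= mkN -Pdiv.IdomainMonic.modpE ?monicXn //.
  rewrite coprimep_modr coprimep_expl // coprimep_sym.
  have := coprimep_XsubC (mbar k i) 0; rewrite subr0 => ->.
  by rewrite rootE horner_coef0 coef0_mbar // oner_eq0.
have := congr1 (@polyn _ _) (qpoly_mulVz cop).
rewrite -[qpoly_inv _]/(winv k i) poly_of_qpolyM /=.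
move: (winv k i : {poly F}) => w; rewrite mkN.
by rewrite -!Pdiv.IdomainMonic.modpE ?monicXn // modp_mul.
Qed.

End Array.
End Code.

(* Main.v *)
Require Import Defs.
From mathcomp Require Import all_boot all_order all_algebra.
From mathcomp Require Import zify ring.
Set Implicit Arguments.
Unset Strict Implicit.
Unset Printing Implicit Defensive.
Import GRing.Theory.
Local Open Scope ring_scope.

(** Put [N = n - k_i].  The monomialized syndrome is the quotient of
    [Y x^N] by [m]: [Y x^N] and [S m] differ by a polynomial of degree less
    than [n], that is, [Y / m] and [S / x^N] agree as series in [1/x] up to
    [x^-N].  Hence, for [Lambda] of degree at most [t <= N], the products
    [Y Lambda] and [S Lambda] have the same quotient by [m] and [x^N]
    respectively as soon as one of the remainders is as small as required, and
    then so is the other.  An SPI solution of either system has degree at most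
    [t], because [Lambda_E] satisfies both, and [C Lambda] is too small to
    influence the inequalities. *)

(** * Comparison of quotients under two different moduli *)

Section PolyFacts.
Variable F : fieldType.
Implicit Types A B M p q Lam : {poly F}.

Lemma size_subp_leq p q d :
  (size p <= d)%N -> (size q <= d)%N -> (size (p - q)%R <= d)%N.
Proof.
by move=> sp sq; rewrite (leq_trans (size_polyD _ _)) // size_polyN geq_max sp.
Qed.

Lemma modp_addr_small M p q d :
  (size q <= d)%N -> (d < size M)%N ->
  (size ((p + q) %% M)%R <= d)%N = (size (p %% M)%R <= d)%N.
Proof.
move=> sq dM; rewrite modpD (modp_small (leq_ltn_trans sq dM)).
apply/idP/idP => h; last by rewrite (leq_trans (size_polyD _ _)) // geq_max h.
by rewrite -[p %% M](addrK q) size_subp_leq.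
Qed.

(** If [q] and [r] are the quotient and remainder of [A * Lam] by [M1], then [B * Lam - q * M2],
    multiplied by [M1], equals [r * M2] minus the small term [D]. Cancelling the degree of [M1]
    makes it smaller than [M2], so [q] is also the quotient of [B * Lam] by [M2]. *)
Lemma divp_transfer A B M1 M2 Lam a b :
  M1 != 0 -> (b < size M2)%N ->
  (a + (size M2).-1 <= b + (size M1).-1)%N ->
  (size ((A * M2 - B * M1) * Lam)%R <= b + (size M1).-1)%N ->
  (size ((A * Lam) %% M1)%R <= a)%N ->
  (A * Lam) %/ M1 = (B * Lam) %/ M2 /\ (size ((B * Lam) %% M2)%R <= b)%N.
Proof.
move=> nzM1 bM2 ab sD sr.
set q := _ %/ M1; set r := _ %% M1 in sr; set D := _ * Lam in sD.
have eA : A * Lam = q * M1 + r by apply: divp_eq.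
have M2_gt0 := leq_ltn_trans (leq0n b) bM2.
have M1_gt0 : (0 < size M1)%N by rewrite size_poly_gt0.
have eM1 : (B * Lam - q * M2) * M1 = r * M2 - D.
  have -> : r = A * Lam - q * M1 by rewrite eA; ring.
  by rewrite /D; ring.
have sB : (size (B * Lam - q * M2)%R <= b)%N.
  have [->|nz] := eqVneq (B * Lam - q * M2) 0; first by rewrite size_poly0.
  have : (size (r * M2 - D)%R <= b + (size M1).-1)%N.
    apply: size_subp_leq => //; apply: leq_trans (size_polyMleq r M2) _.
    by rewrite -(prednK M2_gt0) addnS (leq_trans _ ab) // leq_add2r.
  by rewrite -eM1 size_mul // -(prednK M1_gt0) addnS leq_add2r.
have eB : B * Lam = q * M2 + (B * Lam - q * M2) by ring.
have sB' := leq_ltn_trans sB bM2.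
by rewrite eB divp_addl_mul_small // modp_addl_mul_small.
Qed.

Lemma coef_modXn N p u : (u < N)%N -> (p %% 'X^N)`_u = p`_u.
Proof.
move=> uN; rewrite [p in RHS](divp_eq p 'X^N) coefD coefMXn uN add0r //.
Qed.

Lemma coef_mul_eq_low p q q' u :
  (forall j, (j <= u)%N -> q`_j = q'`_j) -> (p * q)`_u = (p * q')`_u.
Proof.
by move=> eq_q; rewrite !coefM; apply: eq_bigr => j _; rewrite eq_q ?leq_subr.
Qed.

End PolyFacts.

(** * Reversal of coefficients *)

Section Reversal.
Variable F : finFieldType.
Implicit Types p q : {poly F}.

Lemma coef_reversal d p j : (j <= d)%N -> (reversal d p)`_j = p`_(d - j).
Proof. by move=> jd; rewrite coef_poly ltnS jd. Qed.

Lemma reversalE d p : reversal d p = \sum_(i < d.+1) p`_i *: 'X^(d - i).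
Proof.
rewrite /reversal poly_def (reindex_inj rev_ord_inj) /=.
by apply: eq_bigr => i _; rewrite subSS subKn // -ltnS.
Qed.

Lemma reversal_sum d I (r : seq I) (G : I -> {poly F}) :
  reversal d (\sum_(i <- r) G i) = \sum_(i <- r) reversal d (G i).
Proof.
apply/polyP => j; rewrite coef_sum coef_poly.
under [RHS]eq_bigr => i _ do rewrite coef_poly.
by case: ifP => _; [rewrite coef_sum | rewrite big1].
Qed.

Lemma reversalZXn d c i : (i <= d)%N ->
  reversal d (c *: 'X^i : {poly F}) = c *: 'X^(d - i).
Proof.
move=> id; apply/polyP => j; rewrite coef_poly !coefZ !coefXn.
case: ltnP => jd; last by rewrite (_ : j == _ = false) ?mulr0 //; lia.
by rewrite (_ : (d - j == i) = (j == d - i))%N //; lia.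
Qed.

(** Both sides are bilinear, so it suffices to compare monomials, where [d - i] and [e - j] add up
    to [(d + e) - (i + j)]. *)
Lemma reversalM d e p q : (size p <= d.+1)%N -> (size q <= e.+1)%N ->
  reversal (d + e) (p * q) = reversal d p * reversal e q.
Proof.
have widen (r : {poly F}) f : (size r <= f.+1)%N -> r = \sum_(i < f.+1) r`_i *: 'X^i.
  move=> sr; rewrite -poly_def; apply/polyP => j; rewrite coef_poly.
  by case: ltnP => // fj; rewrite nth_default // (leq_trans sr).
move=> sp sq; rewrite [X in reversal _ (X * _)](widen _ _ sp).
rewrite [X in reversal _ (_ * X)](widen _ _ sq) (reversalE d) (reversalE e).
rewrite !big_distrlr reversal_sum /=.
apply: eq_bigr => i _; rewrite reversal_sum; apply: eq_bigr => j _ /=.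
have id := ltn_ord i; have je := ltn_ord j.
rewrite -!scalerAl -!scalerAr !scalerA -!exprD reversalZXn; last by lia.
by congr (_ *: 'X^_); lia.
Qed.

Lemma reversalK d p : (size p <= d.+1)%N -> reversal d (reversal d p) = p.
Proof.
move=> sp; apply/polyP => j; rewrite coef_poly; case: ltnP => jd.
  by rewrite coef_reversal ?leq_subr // subKn.
by rewrite nth_default // (leq_trans sp).
Qed.

End Reversal.

(** * SPI problems that agree up to a degree bound *)

Section SPITransfer.
Variables (F : fieldType) (L : nat).
Implicit Types (b m : 'I_L -> {poly F}) (tau : 'I_L -> nat).

(** A known solution [p] bounds the size of every minimal one, so the two systems need to be
    compared only up to that size; a competitor larger than [p] cannot beat [Lam]. *)
Lemma spi_solution_transfer {b m tau b' m' tau' p} :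
  p != 0 -> spi_ineqs b m tau p ->
  (forall Lam : {poly F}, (size Lam <= size p)%N ->
     spi_ineqs b m tau Lam <-> spi_ineqs b' m' tau' Lam) ->
  forall Lam, spi_solution b m tau Lam -> spi_solution b' m' tau' Lam.
Proof.
move=> nzp solp eqv Lam [nz sol minL].
have sLam : (size Lam <= size p)%N by exact: minL.
split=> // [|Lam' nz' sol']; first exact/eqv.
have [le|/ltnW gt] := leqP (size Lam') (size p); last exact: leq_trans gt.
by apply: minL => //; apply/eqv.
Qed.

Lemma eq_spi_solution_is {b m tau b' m' tau' p} :
  p != 0 -> spi_ineqs b m tau p ->
  (forall Lam : {poly F}, (size Lam <= size p)%N ->
     spi_ineqs b m tau Lam <-> spi_ineqs b' m' tau' Lam) ->
  spi_solution_is b m tau p <-> spi_solution_is b' m' tau' p.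
Proof.
move=> nzp solp eqv.
have solp' : spi_ineqs b' m' tau' p by apply/eqv.
have eqv' (Lam : {poly F}) (le : (size Lam <= size p)%N) := iff_sym (eqv Lam le).
have to := spi_solution_transfer nzp solp eqv.
have from := spi_solution_transfer nzp solp' eqv'.
split=> H Lam; rewrite -(H Lam); split; by [exact: to | exact: from].
Qed.

End SPITransfer.

(** * Error locators and syndromes *)

Section Code.
Variables (F : finFieldType) (n L : nat) (beta : 'I_n -> F) (k : 'I_L -> nat).
Hypothesis beta_inj : injective beta.
Implicit Types (C E Y : 'M[F]_(L, n)) (i : 'I_L).

Local Notation m := (nodepoly beta).
Local Notation t E := #|errset E|.

Lemma size_nodepoly : size m = n.+1.
Proof. by rewrite size_prod_XsubC [index_enum _]unlock -enumT size_enum_ord. Qed.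

Lemma nodepoly_neq0 : m != 0.
Proof. by rewrite -size_poly_gt0 size_nodepoly. Qed.

Lemma size_rowpoly Y i : (size (rowpoly beta Y i) <= n)%N.
Proof. exact: size_npoly. Qed.

Lemma rowpolyD C E i :
  rowpoly beta (C + E) i = rowpoly beta C i + rowpoly beta E i.
Proof.
rewrite /rowpoly; suff -> : psi_inv beta (row i (C + E)) =
  psi_inv beta (row i C) + psi_inv beta (row i E) by [].
apply: (psi_inj beta_inj); rewrite psi_invK //.
apply/rowP => l; rewrite !mxE /= hornerD.
have ev v : (psi_inv beta v).[beta l] = v 0 l.
  by have /rowP/(_ l) := psi_invK beta_inj v; rewrite mxE.
by rewrite !ev !mxE.
Qed.

Lemma rowpoly_node E i l : (rowpoly beta E i).[beta l] = E i l.
Proof. by have /rowP/(_ l) := psi_invK beta_inj (row i E); rewrite !mxE. Qed.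

Lemma size_errloc E : size (errloc beta E) = (t E).+1.
Proof.
rewrite /errloc -big_enum -(big_map beta xpredT (fun x => 'X - x%:P)).
by rewrite size_prod_XsubC size_map cardE.
Qed.

Lemma errloc_neq0 E : errloc beta E != 0.
Proof. by rewrite -size_poly_gt0 size_errloc. Qed.

(** Every node is a root of the product: of the locator at an error position, of the row polynomial
    elsewhere. The nodes are distinct. *)
Lemma nodepoly_dvd_rowpoly_errloc E i : m %| rowpoly beta E i * errloc beta E.
Proof.
rewrite /nodepoly -(big_map beta xpredT (fun x => 'X - x%:P)).
apply: uniq_roots_dvdp; last first.
  by rewrite uniq_rootsE map_inj_uniq // index_enum_uniq.
apply/allP => _ /mapP[l _ ->]; rewrite rootM.
have [lU|lU] := boolP (l \in errset E).
  by rewrite /errloc (bigD1 l) //= rootM root_XsubC eqxx orbT.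
rewrite rootE rowpoly_node; move: lU; rewrite inE negbK => /eqP/colP/(_ i).
by rewrite !mxE => ->; rewrite eqxx.
Qed.

Lemma coef_nodepoly_reversal i j : (k i < n)%N -> (j < n - k i)%N ->
  (reversal n m)`_j = (mbar beta k i)`_j.
Proof.
move=> ki jN; rewrite /mbar !coef_reversal; [|lia|lia].
by rewrite coef_poly ifT; [congr (_`__); lia | lia].
Qed.

(** Since [winv] inverts [mbar] modulo ['X^(n - k i)], the product is congruent to [synd_rev], which
    lists the top coefficients of the row polynomial in descending order. *)
Lemma coef_synd_series_mbar Y i u : (k i < n)%N -> (u < n - k i)%N ->
  (synd_series beta k Y i * mbar beta k i)`_u = (rowpoly beta Y i)`_(n.-1 - u).
Proof.
move=> ki uN; rewrite -(coef_modXn _ uN) /synd_series.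
rewrite [_ * mbar _ _ _]mulrC modp_mul mulrA [mbar _ _ _ * _]mulrC.
rewrite [_ * synd_rev _ _ _ _]mulrC -modp_mul winvP // mulr1 coef_modXn //.
rewrite /synd_rev coef_reversal; last by lia.
by rewrite coef_poly ifT; [congr (_`__); lia | lia].
Qed.

Lemma mono_syndP Y i : (k i < n)%N ->
  (size (rowpoly beta Y i * 'X^(n - k i) - mono_synd beta k Y i * m)%R <= n)%N.
Proof.
move=> ki; set N := (n - k i)%N; have N_gt0 : (0 < N)%N by rewrite subn_gt0.
set s := synd_series beta k Y i.
have ss : (size s <= (N - 1).+1)%N.
  have : (size s < size ('X^N : {poly F}))%N.
    by rewrite ltn_modpN0 // -size_poly_gt0 size_polyXn.
  by rewrite size_polyXn; lia.
have sm : (size m <= n.+1)%N by rewrite size_nodepoly.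
have srm : (size (reversal n m) <= n.+1)%N by exact: size_poly.
(* The coefficients from degree [n] on thus become the [N] lowest coefficients of
   [s * reversal n m], where [reversal n m] may be replaced by [mbar]. *)
have -> : mono_synd beta k Y i * m = reversal (N - 1 + n) (s * reversal n m).
  by rewrite reversalM // reversalK.
apply/leq_sizeP => j nj; rewrite coefB coefMXn coef_poly ltnNge.
have -> /= : (N <= j)%N by lia.
have [jN|jN] := ltnP j (N - 1 + n).+1; last first.
  by rewrite subr0 nth_default // (leq_trans (size_rowpoly _ _)) //; lia.
apply/eqP; rewrite subr_eq0; apply/eqP.
set u := (N - 1 + n - j)%N; have uN : (u < N)%N by rewrite /u; lia.
rewrite (@coef_mul_eq_low _ s _ (mbar beta k i)); last first.
  by move=> l lu; apply: coef_nodepoly_reversal => //; apply: leq_ltn_trans uN.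
by rewrite coef_synd_series_mbar //; congr (_`__); rewrite /u; lia.
Qed.

Lemma mono_synd_transfer Y i (t : nat) (Lam : {poly F}) :
  (k i < n)%N -> (t <= n - k i)%N -> (size Lam <= t.+1)%N ->
  [/\ (size ((rowpoly beta Y i * Lam) %% m)%R <= k i + t)%N =
        (size ((mono_synd beta k Y i * Lam) %% 'X^(n - k i))%R <= t)%N
    & (size ((rowpoly beta Y i * Lam) %% m)%R <= k i + t)%N ->
      (rowpoly beta Y i * Lam) %/ m =
      (mono_synd beta k Y i * Lam) %/ 'X^(n - k i)].
Proof.
move=> ki tN sL; set A := rowpoly beta Y i; set S := mono_synd beta k Y i.
have sD : (size ((A * 'X^(n - k i) - S * m) * Lam)%R <= t + n)%N.
  apply: leq_trans (size_polyMleq _ _) _.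
  have := mono_syndP Y ki; rewrite -/A -/S.
  move: (size (A * _ - _)%R) (size Lam) sL => d l; lia.
(* The degree condition holds with equality in both directions: [(k i + t) + (n - k i) = t + n]. *)
have to := @divp_transfer _ A S m 'X^(n - k i) Lam (k i + t) t nodepoly_neq0.
have from := @divp_transfer _ S A 'X^(n - k i) m Lam t (k i + t).
rewrite size_polyXn size_nodepoly /= in to from.
have {}to := to tN ltac:(lia) sD.
split=> [|/to[]//]; apply/idP/idP => [/to[]//|h].
apply: (proj2 (from _ _ _ _ h)); [|lia|lia|].
  by rewrite -size_poly_gt0 size_polyXn.
rewrite -opprB mulNr size_polyN (leq_trans sD) //; lia.
Qed.

(** The codeword contributes a product of degree less than [k i + t], and [k i + t <= n], so
    reduction modulo [m] leaves it unchanged and within the bound. *)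
Lemma codeword_remainder C E i (t : nat) (Lam : {poly F}) :
  codeword beta k C -> (k i < n)%N -> (t <= n - k i)%N ->
  (size Lam <= t.+1)%N ->
  (size ((rowpoly beta (C + E) i * Lam) %% m)%R <= k i + t)%N =
  (size ((rowpoly beta E i * Lam) %% m)%R <= k i + t)%N.
Proof.
move=> Ccode ki tN sL; rewrite rowpolyD mulrDl addrC modp_addr_small //.
  apply: leq_trans (size_polyMleq _ _) _; move: (Ccode i) sL.
  move: (size _) (size _) => c l; lia.
rewrite size_nodepoly; lia.
Qed.

End Code.

Theorem theorem3 (F : finFieldType) (n L : nat) (beta : 'I_n -> F)
    (k : 'I_L -> nat) (C E Y : 'M[F]_(L, n))
    (beta_inj : injective beta) (L_ge1 : (1 <= L)%N) (k_lt : (kmax k < n)%N)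
    (C_code : codeword beta k C) (Y_def : Y = C + E)
    (E_card : (#|errset E| <= n - kmax k)%N) :
  (partial_inverse_condition beta k E <->
   spi_solution_is (mono_synd beta k Y) (fun i => 'X^(n - k i))
     (fun=> #|errset E|) (errloc beta E)) /\
  (partial_inverse_condition beta k E ->
   forall i : 'I_L,
     (rowpoly beta Y i * errloc beta E) %/ nodepoly beta =
     (mono_synd beta k Y i * errloc beta E) %/ 'X^(n - k i)).
Proof.
have k_le i : (k i <= kmax k)%N by apply: leq_bigmax.
have ki i : (k i < n)%N := leq_ltn_trans (k_le i) k_lt.
have tN i : (#|errset E| <= n - k i)%N.
  by apply: leq_trans E_card _; apply: leq_sub2l.
set t := #|errset E| in E_card tN *.
have sE : size (errloc beta E) = t.+1 by apply: size_errloc.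
have solE : spi_ineqs (rowpoly beta E) (fun=> nodepoly beta)
    (fun i => (k i + t)%N) (errloc beta E).
  by move=> i; rewrite (eqP (nodepoly_dvd_rowpoly_errloc beta_inj E i)) size_poly0.
(* The quotient identity is treated first: the remainder of [E] times its locator is zero, and
   adding the codeword keeps it within the bound. *)
split=> [|_ i]; last first.
  have le : (size (errloc beta E) <= t.+1)%N by rewrite sE.
  have [_ -> //] := mono_synd_transfer beta Y (ki i) (tN i) le.
  by rewrite Y_def codeword_remainder.
have eqv : spi_solution_is (rowpoly beta E) (fun=> nodepoly beta)
      (fun i => (k i + t)%N) (errloc beta E) <->
    spi_solution_is (mono_synd beta k Y) (fun i => 'X^(n - k i))
      (fun=> t) (errloc beta E).
  (* The error locator serves as the known solution, which restricts the comparison to [Lam] of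
     degree at most [t]. *)
  apply: eq_spi_solution_is (errloc_neq0 _ _) solE _ => Lam; rewrite sE => le.
  have E_i i : (size ((rowpoly beta E i * Lam) %% nodepoly beta)%R <= k i + t)%N =
      (size ((mono_synd beta k Y i * Lam) %% 'X^(n - k i))%R <= t)%N.
    have [<- _] := mono_synd_transfer beta Y (ki i) (tN i) le.
    by rewrite Y_def codeword_remainder.
  by split=> H i; have := H i; rewrite E_i.
by rewrite /partial_inverse_condition -eqv; split=> [[]|].
Qed.
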